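(* Let $r,n$ be positive integers with $n\ge r+1$, and let $G$ be a simple graph of order $n$ with edge connectivity $r$ and minimum degree $r$. Then $\tau(G)\le r\,n^{r-1}(n-1)^{n-r-2}$, with equality if and only if $G\cong (K_1\cup K_{n-r-1})\vee K_r$.
   Context: All graphs are finite and simple. $\tau(G)$ denotes the number of spanning trees of $G$. The edge connectivity of a connected graph $G$ is the minimum size of a set $U\subseteq E(G)$ such that $G-U$ is disconnected. $K_m$ is the complete graph on $m$ vertices, $\cup$ is disjoint union and $\vee$ is the join (disjoint union plus all edges between the two parts). *)

(* Defs.v *)
From HB Require Import structures.
From mathcomp Require Import all_boot all_order all_algebra.

Set Implicit Arguments.
Unset Strict Implicit.
Unset Printing Implicit Defensive.

Record sgraph := SGraph {
  vertex :> finType;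
  adj : rel vertex;
  adj_sym : symmetric adj;
  adj_irr : irreflexive adj
}.

Definition edges (G : sgraph) : {set {set G}} :=
  [set [set x; y] | x in G, y in G & adj x y].

Section SpanningSubgraph.
Variables (G : sgraph) (F : {set {set G}}).

Definition spanning_adj : rel G :=
  fun x y => adj x y && ([set x; y] \in F).

Lemma spanning_adj_sym : symmetric spanning_adj.
Proof. by move=> x y; rewrite /spanning_adj adj_sym setUC. Qed.

Lemma spanning_adj_irr : irreflexive spanning_adj.
Proof. by move=> x; rewrite /spanning_adj adj_irr. Qed.

Definition spanning_subgraph : sgraph :=
  SGraph spanning_adj_sym spanning_adj_irr.

End SpanningSubgraph.

Definition del_edges (G : sgraph) (U : {set {set G}}) : sgraph :=
  spanning_subgraph (edges G :\: U).

Definition connected (G : sgraph) : bool :=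
  (0 < #|G|) && [forall x : G, forall y : G, connect (@adj G) x y].

(* A graph cycle is a duplicate-free closed walk on at least 3 vertices.  Such
   a sequence has at most #|G| terms, so bounding its length loses nothing and
   makes the property boolean. *)
Definition acyclic (G : sgraph) : bool :=
  [forall k : 'I_#|G|.+1, forall c : k.-tuple G,
     (2 < k) ==> ~~ ucycleb (@adj G) c].

Definition is_tree (G : sgraph) : bool := connected G && acyclic G.

Definition tau (G : sgraph) : nat :=
  #|[set F : {set {set G}} |
      (F \subset edges G) && is_tree (spanning_subgraph F)]|.

(* As soon as G has two vertices, edges G itself is a disconnecting set, so the
   arg min is a genuine minimum.  The value is 0 on graphs with at most one
   vertex, and on disconnected graphs. *)
Definition edge_connectivity (G : sgraph) : nat :=
  #|[arg min_(U < edges G | (U \subset edges G) && ~~ connected (del_edges U))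
       #|U|]|.

Definition degree (G : sgraph) (x : G) : nat := #|[set y : G | adj x y]|.

(* Every degree is less than #|G|, so the unit #|G| only matters when G has no
   vertex. *)
Definition min_degree (G : sgraph) : nat :=
  \big[minn/#|G|]_(x : G) degree x.

Section CompleteGraph.
Variable m : nat.

Definition complete_adj : rel 'I_m := fun x y => x != y.

Lemma complete_adj_sym : symmetric complete_adj.
Proof. by move=> x y; rewrite /complete_adj eq_sym. Qed.

Lemma complete_adj_irr : irreflexive complete_adj.
Proof. by move=> x; rewrite /complete_adj eqxx. Qed.

Definition complete_graph : sgraph :=
  SGraph complete_adj_sym complete_adj_irr.

End CompleteGraph.

Section UnionJoin.
Variables G H : sgraph.

(* [cross] is the adjacency between the two parts. *)
Definition sum_adj (cross : bool) : rel (G + H) := fun u v =>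
  match u, v with
  | inl x, inl y => adj x y
  | inr x, inr y => adj x y
  | _, _ => cross
  end.

Lemma sum_adj_sym cross : symmetric (sum_adj cross).
Proof. by move=> [x|x] [y|y] //=; rewrite adj_sym. Qed.

Lemma sum_adj_irr cross : irreflexive (sum_adj cross).
Proof. by move=> [x|x] /=; rewrite adj_irr. Qed.

Definition graph_union : sgraph :=
  SGraph (sum_adj_sym false) (sum_adj_irr false).

Definition graph_join : sgraph :=
  SGraph (sum_adj_sym true) (sum_adj_irr true).

End UnionJoin.

Definition graph_iso (G H : sgraph) : Prop :=
  exists2 f : G -> H, bijective f & forall x y, adj (f x) (f y) = adj x y.

(* Main.v *)
(* Fix a vertex v of degree r and let N be its neighbourhood. Orienting a
   spanning tree towards v identifies it with its parent function, so tau(G) is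
   at most the number of all parent functions on the vertex set with root v in
   which only elements of N have parent v; this is the count for the extremal
   graph. Equality forces every edge off v to be present, since each such edge
   occurs in one of these trees.

   To count, peel off the layer W of vertices whose parent is a root: with a
   roots and u non-roots, the number F(a, u) of rooted forests satisfies
   F(a, u) = sum_W a^|W| F(|W|, u - |W|), whence
   (a + u) F(a, u) = a (a + u)^u. Restricting the first layer to W inside N
   gives r n^(r-1) (n-1)^(n-r-2). *)

Require Import Defs.
From HB Require Import structures.
From mathcomp Require Import all_boot all_order all_algebra zify.

Set Implicit Arguments.
Unset Strict Implicit.
Unset Printing Implicit Defensive.

(** * Binomial sums over subsets *)

Lemma sum_binom_mul (a m r : nat) :
  \sum_(k < r.+1) 'C(r, k) * (k * a ^ k * m ^ (r - k)) = r * a * (a + m) ^ r.-1.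
Proof.
case: r => [|r]; first by rewrite big_ord_recl big_ord0.
rewrite big_ord_recl /= mul0n muln0 add0n addnC expnDn big_distrr /=.
(* Absorption, [(i+1) C(r+1, i+1) = (r+1) C(r, i)], turns the weighted sum into a plain binomial
   expansion. *)
apply: eq_bigr => i _; rewrite /bump leq0n add1n subSS.
rewrite !mulnA -(mulnC i.+1) -mul_bin_diag /= expnS; nia.
Qed.

Lemma sum_subset_card (T : finType) (U : {set T}) (g : nat -> nat) :
  \sum_(W : {set T} | W \subset U) g #|W| = \sum_(k < #|U|.+1) 'C(#|U|, k) * g k.
Proof.
rewrite (partition_big (fun W : {set T} => inord #|W| : 'I_#|U|.+1) xpredT) //=.
apply: eq_bigr => k _; rewrite -(cards_draws U k) -sum_nat_const.
rewrite [RHS](eq_bigl (fun W : {set T} => (W \subset U) && (inord #|W| == k))).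
  apply: eq_bigr => W /andP[WU /eqP <-]; rewrite inordK // ltnS.
  exact: subset_leq_card.
move=> W; rewrite inE; case: (boolP (W \subset U)) => //= WU.
by rewrite -val_eqE /= inordK // ltnS subset_leq_card.
Qed.

(** Evaluates the layer recursions below: there [W] is a first layer, [a] the number of roots, and
    the factor [#|W|] comes from the forest count with root set [W]. *)
Lemma sum_subset_mul (T : finType) (U : {set T}) (a m : nat) :
  \sum_(W : {set T} | W \subset U) #|W| * a ^ #|W| * m ^ (#|U| - #|W|) =
    #|U| * a * (a + m) ^ #|U|.-1.
Proof.
rewrite -sum_binom_mul.
exact: (sum_subset_card U (fun k => k * a ^ k * m ^ (#|U| - k))).
Qed.

(** * Counting rooted forests by their first layer *)

Section Forests.
Variable T : finType.
Implicit Types (R U W N : {set T}) (f g h : {ffun T -> T}).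

Definition reaches f R x := [exists y in R, fconnect f x y].

Lemma reachesP f R x : reflect (exists k, iter k f x \in R) (reaches f R x).
Proof.
apply: (iffP existsP) => [[y /andP[yR xy]]|[k kR]].
  by exists (findex f x y); rewrite iter_findex.
by exists (iter k f x); rewrite kR fconnect_iter.
Qed.

(* Spanning forests on R :|: U, one tree per root in R, encoded by the parent
   function of the non-roots and made the identity off U. *)
Definition forests R U : {set {ffun T -> T}} :=
  [set f : {ffun T -> T} | [forall x,
    if x \in U then (f x \in R :|: U) && reaches f R x else f x == x]].

Lemma forestsP R U f :
  reflect [/\ forall x, x \in U -> f x \in R :|: U,
              forall x, x \in U -> reaches f R x
            & forall x, x \notin U -> f x = x]
          (f \in forests R U).
Proof.
rewrite inE; apply: (iffP forallP) => [H|[H1 H2 H3] x].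
  split=> x xU; have := H x.
  - by rewrite xU => /andP[].
  - by rewrite xU => /andP[].
  - by rewrite (negPf xU) => /eqP.
by case: ifPn => xU; [rewrite H1 // H2 | rewrite H3].
Qed.

Arguments forestsP {R U f}.

Definition glue W (p : {ffun T -> T} * {ffun T -> T}) : {ffun T -> T} :=
  [ffun x => if x \in W then p.1 x else p.2 x].

Definition restr W f : {ffun T -> T} := [ffun x => if x \in W then f x else x].

(** Pinned to the identity off [W], as in [forests], so that each map from [W] to [R] is counted
    once. *)
Definition maps_to W R : {set {ffun T -> T}} :=
  [set f in family (fun x => if x \in W then mem R else mem (pred1 x))].

Lemma maps_toP W R f :
  reflect ((forall x, x \in W -> f x \in R) /\ (forall x, x \notin W -> f x = x))
          (f \in maps_to W R).
Proof.
rewrite inE; apply: (iffP familyP) => [H|[H1 H2] x].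
  by split=> x xW; have := H x; rewrite ?xW // (negPf xW) => /eqP.
by case: ifPn => xW; [exact: H1 | rewrite inE; apply/eqP/H2].
Qed.

Lemma card_maps_to W R : #|maps_to W R| = #|R| ^ #|W|.
Proof.
rewrite cardsE card_family foldrE big_map big_enum /=.
rewrite -prod_nat_const [RHS]big_mkcond /=; apply: eq_bigr => x _.
by case: ifP => // _; rewrite card1.
Qed.

(** Cutting a forest below its first layer [W] leaves an arbitrary map from [W] to [R] and a forest
    on the remaining vertices with root set [W]; [glue] and [restr] undo each other. *)
Lemma forests_layer R U W : [disjoint R & U] -> W \subset U ->
  #|[set f in forests R U | [set x in U | f x \in R] == W]| =
    #|R| ^ #|W| * #|forests W (U :\: W)|.
Proof.
move=> dRU WU; rewrite -card_maps_to -cardsX.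
have UR x : x \in U -> x \notin R.
  by move=> xU; rewrite (disjointFl dRU xU).
have glueK f : f \in forests R U -> f = glue W (restr W f, restr (U :\: W) f).
  move/forestsP=> [_ _ fU]; apply/ffunP => x; rewrite !ffunE /= inE.
  by case: (boolP (x \in W)) => //= _; case: ifPn => //; exact: fU.
have glue_inj : {in setX (maps_to W R) (forests W (U :\: W)) &, injective (glue W)}.
  move=> [g h] [g' h'] /setXP[/maps_toP[_ g1] /forestsP[_ _ h1]].
  move=> /setXP[/maps_toP[_ g2] /forestsP[_ _ h2]] /ffunP E.
  congr pair; apply/ffunP => x; have := E x; rewrite !ffunE /=;
    case: ifPn => xW // _; first by rewrite g1 // g2.
  by rewrite h1 ?h2 // !inE xW.
rewrite -(card_in_imset glue_inj); congr #|pred_of_set _|; apply/setP => f.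
apply/idP/imsetP => [|[[g h] /setXP[/maps_toP[gW gN] /forestsP[hU hR hN]] ->]].
  rewrite inE => /andP[fF /eqP fW]; exists (restr W f, restr (U :\: W) f);
    last exact: glueK.
  have [fU fR fN] := forestsP fF.
  have inW x : x \in U -> (f x \in R) = (x \in W) by move=> xU; rewrite -fW inE xU.
  apply/setXP; split; first apply/maps_toP; last apply/forestsP; split.
  - by move=> x xW; rewrite ffunE xW inW // (subsetP WU).
  - by move=> x /negPf xW; rewrite ffunE xW.
  - move=> x xUW; rewrite ffunE xUW; move: xUW => /setDP[xU xW].
    by have := fU x xU; rewrite !inE inW // (negPf xW) /=; case: (_ \in W).
  (* A walk from [U] into [R] passes through [W] just before it enters [R]; up to there [restr]
     agrees with [f]. *)
  - move=> x /setDP[xU _]; have /reachesP[k kR] := fR x xU; apply/reachesP.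
    elim: k x xU kR => [|k IH] x xU /=; first by rewrite (negPf (UR x xU)).
    rewrite -iterS iterSr => kR; case: (boolP (x \in W)) => xW; first by exists 0.
    have fxU : f x \in U by have := fU x xU; rewrite inE inW // (negPf xW).
    have [j jW] := IH _ fxU kR; exists j.+1; rewrite iterSr.
    by rewrite [restr _ _ x]ffunE inE xW xU.
  - by move=> x /negPf xW; rewrite ffunE xW.
have hU' x : x \in U -> x \notin W -> h x \in U.
  move=> xU xW; have /hU : x \in U :\: W by rewrite inE xW.
  by rewrite !inE; case: (boolP (h x \in W)) => // /(subsetP WU).
rewrite inE; apply/andP; split; last first.
  apply/eqP/setP => x; rewrite !inE ffunE /=.
  case: ifPn => xW; first by rewrite gW // (subsetP WU).
  by case: (boolP (x \in U)) => //= xU; apply/negbTE/UR/hU'.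
apply/forestsP; split.
- move=> x xU; rewrite ffunE /= inE; case: ifPn => xW; first by rewrite gW.
  by rewrite hU' ?orbT.
(* Conversely, follow [h] up to [W]; one step of [g] then ends in [R]. *)
- move=> x xU; have : exists k, iter k h x \in W.
    case: (boolP (x \in W)) => xW; first by exists 0.
    by apply/reachesP/hR; rewrite inE xW.
  case=> k kW; apply/reachesP; elim: k x xU kW => [|k IH] x xU.
    by move=> /= xW; exists 1; rewrite /= ffunE xW gW.
  case: (boolP (x \in W)) => xW; first by exists 1; rewrite /= ffunE xW gW.
  rewrite iterSr => kW; have [j jR] := IH _ (hU' x xU xW) kW.
  by exists j.+1; rewrite iterSr [glue _ _ x]ffunE /= (negPf xW).
- move=> x xU; have xW : x \notin W by apply: contraNN xU; apply: (subsetP WU).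
  by rewrite ffunE (negPf xW) hN // inE xW.
Qed.

(** [N := U] gives the recursion for all forests; a smaller [N] restricts which vertices may hang
    from a root. *)
Lemma card_forests_layers R U N : [disjoint R & U] -> N \subset U ->
  #|[set f in forests R U | [set x in U | f x \in R] \subset N]| =
    \sum_(W : {set T} | W \subset N) #|R| ^ #|W| * #|forests W (U :\: W)|.
Proof.
move=> dRU NU; rewrite -sum1_card.
rewrite (partition_big (fun f : {ffun T -> T} => [set x in U | f x \in R])
  (fun W => W \subset N)) => [|f]; last by rewrite inE => /andP[].
apply: eq_bigr => W WN; rewrite -forests_layer ?(subset_trans WN) //.
rewrite -sum1_card; apply: eq_bigl => f; rewrite !inE.
by rewrite -andbA; congr andb; rewrite andbC; case: eqP => // ->.
Qed.

Lemma forests0 U : U != set0 -> forests set0 U = set0.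
Proof.
case/set0Pn => x xU; apply/setP => f; rewrite in_set0; apply/negP.
by case/forestsP => _ /(_ x xU) /reachesP[k]; rewrite in_set0.
Qed.

(** The count is [a (a + u)^(u - 1)]; the extra factor [a + u] keeps the exponent natural when
    [u = 0]. The proof is by strong induction on [u]. *)
Lemma card_forests R U : [disjoint R & U] ->
  (#|R| + #|U|) * #|forests R U| = #|R| * (#|R| + #|U|) ^ #|U|.
Proof.
have [u] := ubnP #|U|; elim: u => // u IH in R U *; rewrite ltnS => Uu dRU.
have [U0|U_n0] := eqVneq U set0.
  rewrite U0 cards0 addn0; congr muln.
  rewrite (_ : forests R set0 = [set [ffun x => x]]) ?cards1 //.
  apply/setP => f; rewrite in_set1; apply/forestsP/eqP => [[_ _ H]|->].
    by apply/ffunP => x; rewrite ffunE H // in_set0.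
  by split=> x; rewrite ?in_set0 // ffunE.
have U_gt0 : 0 < #|U| by rewrite card_gt0.
have -> : forests R U = [set f in forests R U | [set x in U | f x \in R] \subset U].
  apply/setP => f; rewrite [RHS]inE; case: (f \in _) => //=; symmetry.
  by apply/subsetP => x; rewrite inE => /andP[].
rewrite card_forests_layers //.
(* Since [#|W| + #|U :\: W| = #|U|], the factor [#|U|] is the one that the induction hypothesis for
   [W] and [U :\: W] asks for. *)
suff E : #|U| * (\sum_(W : {set T} | W \subset U) #|R| ^ #|W| * #|forests W (U :\: W)|) =
  #|U| * (#|R| * (#|R| + #|U|) ^ #|U|.-1).
  move/eqP: E; rewrite eqn_pmul2l // => /eqP ->.
  by rewrite mulnCA -expnS prednK.
rewrite [RHS]mulnA -sum_subset_mul big_distrr /=; apply: eq_bigr => W WU.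
have cU : #|W| + #|U :\: W| = #|U| by rewrite -(cardsID W U) (setIidPr WU).
rewrite mulnCA [#|W| * _]mulnC -[RHS]mulnA; congr muln.
(* For an empty layer [U :\: W] is not smaller than [U], but both sides vanish. *)
have [->|W_n0] := eqVneq W set0.
  by rewrite setD0 forests0 // !cards0 muln0.
rewrite -cU addKn IH //.
  have : 0 < #|W| by rewrite card_gt0.
  by lia.
by rewrite -setI_eq0 setIDA setDE setIAC setICr set0I.
Qed.

End Forests.
Arguments forestsP {T R U f}.

(** * Trees with a single root *)

Section RootedTrees.
Variables (T : finType) (v : T).
Implicit Types (N : {set T}) (f : {ffun T -> T}).

(** The root is left out of the layer because it is its own parent. *)
Definition rooted N : {set {ffun T -> T}} :=
  [set f in forests [set v] [set~ v]
    | [set x in [set~ v] | f x \in [set v]] \subset N].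

Lemma card_rooted N : v \notin N -> 1 < #|T| ->
  #|T|.-1 * #|rooted N| = #|N| * #|T| ^ #|N|.-1 * #|T|.-1 ^ (#|T|.-1 - #|N|).
Proof.
move=> vN T_gt1; have NU : N \subset [set~ v].
  by apply/subsetP => x xN; rewrite !inE; apply: contraNneq vN => <-.
have cU : #|[set~ v]| = #|T|.-1 by rewrite cardsC1.
have dv : [disjoint [set v] & [set~ v]] by rewrite disjoints1 !inE eqxx.
(* [#|T|] is written as [1 + #|T|.-1] to apply [sum_subset_mul] with one root and [m = #|T|.-1], the
   common value of [#|W| + #|[set~ v] :\: W|]. *)
rewrite card_forests_layers // -[X in #|N| * X ^ _](prednK (ltnW T_gt1)) -add1n.
rewrite -[X in X * _ * _]muln1 -sum_subset_mul big_distrr big_distrl /=.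
apply: eq_bigr => W WN; have WU := subset_trans WN NU.
have cUW : #|W| + #|[set~ v] :\: W| = #|T|.-1.
  by rewrite -cU -(cardsID W [set~ v]) (setIidPr WU).
have dW : [disjoint W & [set~ v] :\: W].
  by rewrite -setI_eq0 setIDA setDE setIAC setICr set0I.
have := card_forests dW; rewrite cUW cards1 !exp1n mul1n muln1 => ->.
rewrite -mulnA -expnD; congr (_ * _ ^ _).
have := subset_leq_card WN; have := subset_leq_card NU; rewrite cU -cUW; lia.
Qed.

Variable f : {ffun T -> T}.
Hypothesis f_forest : f \in forests [set v] [set~ v].

Lemma root_fconnect x : fconnect f x v.
Proof.
have [->|xv] := eqVneq x v; first exact: connect0.
have [_ fR _] := forestsP f_forest.
have /fR/existsP[y /andP[/set1P -> //]] : x \in [set~ v] by rewrite !inE.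
Qed.

(** [findex f x v] is the depth of [x], the measure for the inductions and the acyclicity arguments
    below. *)
Lemma depthS x : x != v -> findex f x v = (findex f (f x) v).+1.
Proof.
by move=> xv; apply: fconnect_findex; [exact: root_fconnect | rewrite eq_sym].
Qed.

Lemma parent_neq x : x != v -> f x != x.
Proof. by move=> xv; apply/eqP => E; have := depthS xv; rewrite E; lia. Qed.

Lemma parent_ind (P : T -> Prop) :
  P v -> (forall x, x != v -> P (f x) -> P x) -> forall x, P x.
Proof.
move=> Pv IH x; have [d] := ubnP (findex f x v); elim: d x => // d IHd x.
have [->//|xv] := eqVneq x v; rewrite depthS // ltnS => /IHd; exact: IH.
Qed.

End RootedTrees.

(** * Spanning trees of a graph as parent functions *)

Lemma set2_eq (T : finType) (x y a b : T) :
  [set x; y] = [set a; b] -> (x = a /\ y = b) \/ (x = b /\ y = a).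
Proof.
move=> E; have xE : x \in [set a; b] by rewrite -E set21.
have yE : y \in [set a; b] by rewrite -E set22.
have aE : a \in [set x; y] by rewrite E set21.
have bE : b \in [set x; y] by rewrite E set22.
move: xE yE aE bE => /set2P xE /set2P yE /set2P aE /set2P bE.
by intuition congruence.
Qed.

Section ParentFunctions.
Variables (G : sgraph) (v : G).
Implicit Types (f g : {ffun G -> G}) (F : {set {set G}}).

Definition parents : {set {ffun G -> G}} :=
  [set f in forests [set v] [set~ v] | [forall x, (x != v) ==> adj x (f x)]].

Lemma parentsP f :
  reflect (f \in forests [set v] [set~ v] /\ forall x, x != v -> adj x (f x))
          (f \in parents).
Proof.
apply: (iffP setIdP) => -[fF H]; split=> //.
  by move=> x xv; move/forallP/(_ x): H; rewrite xv.
by apply/forallP => x; apply/implyP/H.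
Qed.

Definition tree_of f : {set {set G}} := [set [set x; f x] | x in [set~ v]].

Lemma tree_of_adj f x y : f \in parents ->
  spanning_adj (tree_of f) x y =
    (x != v) && (f x == y) || (y != v) && (f y == x).
Proof.
case/parentsP => _ fA; apply/andP/orP.
  case=> _ /imsetP[z]; rewrite !inE => zv /set2_eq[[-> ->]|[-> ->]].
    by left; rewrite zv eqxx.
  by right; rewrite zv eqxx.
case=> /andP[zv /eqP E]; split; rewrite -?E.
- exact: fA.
- by apply: imset_f; rewrite !inE.
- by rewrite adj_sym; exact: fA.
- by rewrite setUC; apply: imset_f; rewrite !inE.
Qed.

Lemma tree_of_edges f : f \in parents -> tree_of f \subset edges G.
Proof.
case/parentsP => _ fA; apply/subsetP => A /imsetP[x]; rewrite !inE => xv ->.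
by apply/imset2P; exists x (f x) => //; rewrite inE fA.
Qed.

Lemma tree_of_connect f : f \in parents ->
  forall x y, connect (spanning_adj (tree_of f)) x y.
Proof.
move=> fP x y.
have csym := sym_connect_sym (@spanning_adj_sym G (tree_of f)).
suff rootc z : connect (spanning_adj (tree_of f)) z v.
  by apply: connect_trans (rootc x) _; rewrite csym.
have [fF _] := parentsP _ fP.
elim/(parent_ind fF): z => [|z zv]; first exact: connect0.
by apply: connect_trans; apply: connect1; rewrite tree_of_adj // zv eqxx.
Qed.

(* In a cycle, both neighbours of a vertex of maximal depth would be its
   parent. *)
Lemma tree_of_acyclic f : f \in parents -> acyclic (spanning_subgraph (tree_of f)).
Proof.
move=> fP; have [fF _] := parentsP _ fP.
apply/forallP => k; apply/forallP => -[c /= /eqP ck]; apply/implyP => k_gt2.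
apply/negP => /andP[]; rewrite -{}ck {k} in k_gt2 *.
have [x0 x0c] : exists x0, x0 \in c.
  by case: c k_gt2 => // x0 c _; exists x0; exact: mem_head.
have [x xc x_max] := @arg_maxnP G x0 (fun z => z \in c) (fun z => findex f z v) x0c.
have up y : y \in c -> spanning_adj (tree_of f) x y -> f x = y.
  move=> yc; rewrite tree_of_adj // => /orP[/andP[_ /eqP //]|/andP[yv /eqP E]].
  by have := x_max y yc; rewrite (depthS fF yv) E /= ltnn.
(* Rotate the cycle to start at the deepest vertex [x]; its second and last entries [y] and [z] are
   neighbours of [x], at distinct positions because the length exceeds 2. *)
case: (rot_to xc) => i p cE; rewrite -(rot_cycle i) -(rot_uniq i) cE.
have pc z : z \in x :: p -> z \in c by rewrite -cE mem_rot.
have : 2 < size (x :: p) by rewrite -cE size_rot.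
case: p pc {cE} => // y q; case/lastP: q => // q z pc _ /=.
rewrite rcons_path last_rcons /= => /andP[xy /andP[_ zx]] /and3P[_ yq _].
have xz : spanning_adj (tree_of f) x z by rewrite spanning_adj_sym.
have yz : y = z.
  rewrite -(up y) ?(up z) ?pc //; first by rewrite !inE mem_rcons !inE eqxx !orbT.
  by rewrite !inE eqxx orbT.
by rewrite yz mem_rcons mem_head in yq.
Qed.

(** Induction from the root: the edge from [x] to [f x] also comes from [g], so [g x = f x] or
    [g (f x) = x]. As [g] and [f] agree at [f x], the latter gives [f (f x) = x], against depth. *)
Lemma tree_of_inj : {in parents &, injective tree_of}.
Proof.
move=> f g fP gP E; have [fF _] := parentsP _ fP; have [gF _] := parentsP _ gP.
apply/ffunP; elim/(parent_ind fF) => [|x xv IH].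
  have [_ _ fv] := forestsP fF; have [_ _ gv] := forestsP gF.
  by rewrite fv ?gv // !inE eqxx.
have : spanning_adj (tree_of g) x (f x) by rewrite -E tree_of_adj // xv eqxx.
rewrite tree_of_adj // => /orP[/andP[_ /eqP //]|/andP[fxv]].
rewrite -IH => /eqP ffx; have := depthS fF fxv; have := depthS fF xv.
by rewrite ffx; lia.
Qed.

(** Each vertex other than [v] takes as parent a neighbour in [F] closer to [v]. The tree so
    obtained lies in [F], and acyclicity of [F] leaves no further edge. *)
Lemma tree_of_onto F : F \subset edges G -> is_tree (spanning_subgraph F) ->
  exists2 f, f \in parents & F = tree_of f.
Proof.
move=> FE /andP[/andP[_ /forallP conn] acyc].
pose e := @spanning_adj G F.
(* [P x n]: some walk of length [n] in [F] leads from [x] to [v]. Hence [d] below is the distance to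
   [v]. *)
pose P x n := [exists p : n.-tuple G, path e x p && (last x p == v)].
have exP x : exists n, P x n.
  have /connectP[p ep vE] : connect e x v by have /forallP/(_ v) := conn x.
  by exists (size p); apply/existsP; exists (in_tuple p); rewrite ep -vE eqxx.
pose d x := ex_minn (exP x).
have d_lt x : x != v -> exists y, e x y && (d y < d x).
  rewrite /d; case: ex_minnP => -[|n] /existsP[[p /= /eqP pn] /andP[ep /eqP pv]] _ xv.
    by move/size0nil: pn pv xv => -> /= ->; rewrite eqxx.
  case: p pn ep pv => //= y p [pn] /andP[xy ep] pv; exists y; rewrite xy ltnS.
  case: ex_minnP => m _ /(_ n); apply; apply/existsP.
  by exists (Tuple (introT eqP pn)); rewrite /= ep pv eqxx.
pose f : {ffun G -> G} := [ffun x =>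
  if (x != v) then odflt x [pick y | e x y && (d y < d x)] else x].
have fE x : x != v -> e x (f x) /\ d (f x) < d x.
  move=> xv; rewrite ffunE xv; case: pickP => [y /andP[//]|/= none].
  by have [y] := d_lt x xv; rewrite none.
have fP : f \in parents.
  apply/parentsP; split; last by move=> x /fE[/andP[]].
  apply/forestsP; split=> x; rewrite !inE.
  - by move=> _; case: eqP.
  - move=> _; apply/reachesP; have [n] := ubnP (d x).
    elim: n x => // n IH x; rewrite ltnS => dx.
    have [->|xv] := eqVneq x v; first by exists 0; rewrite inE.
    have [_ dfx] := fE x xv.
    have [k kv] := IH (f x) (leq_trans dfx dx).
    by exists k.+1; rewrite iterSr.
  - by rewrite negbK ffunE => /eqP ->; rewrite eqxx.
have sub x y : spanning_adj (tree_of f) x y -> e x y.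
  rewrite tree_of_adj // => /orP[]/andP[zv /eqP <-]; have [] := fE _ zv => //.
  by rewrite /e spanning_adj_sym.
exists f => //; apply/eqP; rewrite eqEsubset; apply/andP; split; last first.
  apply/subsetP => A /imsetP[x]; rewrite !inE => xv ->.
  by have [/andP[]] := fE x xv.
apply/subsetP => A AF; have := subsetP FE A AF.
case/imset2P => x y _; rewrite inE => /andP[_ xy] AE; rewrite {A}AE in AF *.
apply/negPn/negP => xyN.
(* Otherwise a simple path from x to y in [tree_of f], closed up by the edge
   xy of F, is a cycle of F. *)
have /connectP[p0 /shortenP[p ep up _] yE] := tree_of_connect fP x y.
have {}yE : y = last x p by rewrite yE.
(* An empty path would make [xy] a loop; a path of one edge would put [xy] in [tree_of f]. *)
have szp : 1 < size p.
  case: p ep up yE => [|z [|//]] /=; first by move=> _ _ E; rewrite E adj_irr in xy.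
  by move=> /andP[/andP[_ xz] _] _ E; rewrite E xz in xyN.
have szG : size (x :: p) < #|G|.+1 by rewrite ltnS -(card_uniqP up) max_card.
move/forallP/(_ (Ordinal szG))/forallP/(_ (in_tuple (x :: p))): acyc.
move/implyP/(_ szp)/negP; apply; apply/andP; split=> //=.
rewrite rcons_path -yE (sub_path sub ep) /=.
by rewrite /spanning_adj adj_sym xy setUC AF.
Qed.

(** [tree_of] is a bijection onto the spanning trees, whichever vertex [v] serves as root. *)
Lemma tau_parents : tau G = #|parents|.
Proof.
rewrite -(card_in_imset tree_of_inj); congr #|pred_of_set _|; apply/setP => F.
rewrite inE; apply/andP/imsetP => [[FE FT]|[f fP ->]].
  by have [f fP ->] := tree_of_onto FE FT; exists f.
split; first exact: tree_of_edges.
apply/andP; split; last exact: tree_of_acyclic.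
apply/andP; split; first by apply/card_gt0P; exists v.
by apply/forallP => x; apply/forallP => y; exact: tree_of_connect.
Qed.

Let N := [set y | adj v y].

Lemma parents_rooted : parents \subset rooted v N.
Proof.
apply/subsetP => f /parentsP[fF fA]; rewrite inE fF /=; apply/subsetP => x.
by rewrite !inE => /andP[xv /eqP E]; rewrite adj_sym -E fA.
Qed.

(** If [G] is complete off [v], a parent other than [v] is automatically adjacent to its child, and
    children of [v] lie in [N]. The converse realises each pair off [v] as child and parent. *)
Lemma parents_rooted_eq : 0 < #|N| ->
  (parents == rooted v N) =
    [forall x, forall y, [&& x != v, y != v & x != y] ==> adj x y].
Proof.
move=> /card_gt0P[w wN].
have Nv x : x \in N -> x != v by apply: contraTneq => ->; rewrite inE adj_irr.
apply/eqP/forallP => [E|complete]; last first.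
  apply/eqP; rewrite eqEsubset parents_rooted; apply/subsetP => f.
  rewrite inE => /andP[fF fN]; apply/parentsP; split=> // x xv.
  have [fxv|fxv] := eqVneq (f x) v.
    have : x \in N by apply: (subsetP fN); rewrite !inE xv fxv eqxx.
    by rewrite inE fxv adj_sym.
  by have /forallP/(_ (f x)) := complete x; rewrite xv fxv eq_sym (parent_neq fF).
(* Every edge xy off v lies in a spanning tree: y reaches v avoiding x, through
   z when y is not itself a neighbour of v. *)
have adjN x y z : x != v -> y != v -> x != y -> z \in N -> z != x -> adj x y.
  move=> xv yv xy zN zx.
  (* [x] hangs from [y], the other members of [N] from [v], all remaining vertices from [z]. As
     [z != x], no vertex other than [x] passes through [x]. *)
  pose f : {ffun G -> G} := [ffun t => if t == x then y else
    if t \in v |: N then v else z].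
  have fx : f x = y by rewrite ffunE eqxx.
  have fv : f v = v by rewrite ffunE eq_sym (negPf xv) !inE eqxx.
  suff /parentsP[_ /(_ x xv)] : f \in parents by rewrite fx.
  rewrite E; have step t : reaches f [set v] (f t) -> reaches f [set v] t.
    by case/reachesP => k kv; apply/reachesP; exists k.+1; rewrite iterSr.
  have Rv : reaches f [set v] v by apply/reachesP; exists 0; rewrite /= inE.
  have RN t : t != x -> t \in N -> reaches f [set v] t.
    by move=> /negPf tx tN; apply: step; rewrite ffunE tx inE tN orbT.
  have Rx t : t != x -> reaches f [set v] t.
    move=> tx; apply: step; rewrite ffunE (negPf tx).
    by case: ifP => _; [exact: Rv | exact: RN].
  apply/setIdP; split; last first.
    apply/subsetP => t; rewrite !inE => /andP[tv].
    rewrite ffunE; case: (t == x); first by rewrite (negPf yv).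
    rewrite !inE (negPf tv) /=; case: ifP => // _.
    by rewrite (negPf (Nv z zN)).
  apply/forestsP; split=> t; rewrite !inE.
  - by move=> _; case: eqP.
  - move=> _; have [->|] := eqVneq t x; last exact: Rx.
    by apply: step; rewrite fx; apply: Rx; rewrite eq_sym.
  - by rewrite negbK => /eqP ->.
move=> x; apply/forallP => y; apply/implyP => /and3P[xv yv xy].
(* If [w] is [x] itself, exchange the roles of [x] and [y]. *)
have [wx|wx] := eqVneq w x; last exact: adjN wN wx.
by rewrite adj_sym; apply: adjN wN _; rewrite // ?wx // eq_sym.
Qed.

End ParentFunctions.

Lemma enum_subset (T : finType) (A : {set T}) m : #|A| = m ->
  exists2 g : 'I_m -> T, injective g & forall i, g i \in A.
Proof. by move=> <-; exists enum_val; [exact: enum_val_inj | exact: enum_valP]. Qed.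

(** * Recognising the extremal graph *)

Definition extremal r n : sgraph :=
  graph_join (graph_union (complete_graph 1) (complete_graph (n - r - 1)))
             (complete_graph r).

(** The summand [K_1] is [v], the joined [K_r] is its neighbourhood and [K_(n-r-1)] consists of its
    non-neighbours; all pairs off [v] are adjacent. *)
Lemma extremal_isoP (G : sgraph) r :
  graph_iso G (extremal r #|G|) <->
  exists v : G, [/\ degree v = r
    & [forall x, forall y, [&& x != v, y != v & x != y] ==> adj x y]].
Proof.
split=> [[f [h fK hK] fA]|[v [dv /forallP complete]]].
  exists (h (inl (inl ord0))); split.
    apply: etrans (etrans (cardsT 'I_r) (card_ord r)).
    have inr_inj : injective (fun i : 'I_r => h (inr i)).
      by move=> i j /(can_inj hK) [].
    rewrite -(card_imset _ inr_inj); congr #|pred_of_set _|; apply/setP => x.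
    rewrite inE -fA hK; apply/idP/imsetP => [|[i _ ->]]; last by rewrite hK.
    case fx: (f x) => [[i|i]|i] //=; first by rewrite !ord1 /= /complete_adj eqxx.
    by exists i; [rewrite in_setT | exact: (canRL fK fx)].
  apply/forallP => x; apply/forallP => y; apply/implyP => /and3P[xv yv xy].
  rewrite -fA; move: xv yv xy; rewrite -(can_eq fK x) -(can_eq fK y) hK.
  rewrite -(can_eq fK x y).
  by case: (f x) => [[i|i]|i]; case: (f y) => [[j|j]|j]; rewrite ?ord1 ?eqxx.
pose N := [set y | adj v y]; pose M := ~: (v |: N).
have vN : v \notin N by rewrite inE adj_irr.
have cM : #|M| = #|G| - r - 1.
  by rewrite /M cardsCs setCK cardsU1 vN -[#|N|]/(degree v) dv; lia.
have [g g_inj gN] := enum_subset (dv : #|N| = r).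
have [k k_inj kM] := enum_subset cM.
pose h (u : extremal r #|G|) : G := match u with
  | inl (inl _) => v | inl (inr i) => k i | inr j => g j end.
have gv j : g j != v by apply: contraNneq vN => <-.
have kv i : k i != v by have := kM i; rewrite !inE negb_or => /andP[].
have vk i : adj v (k i) = false.
  by have := kM i; rewrite !inE negb_or => /andP[_ /negPf].
have vg j : adj v (g j) by have := gN j; rewrite inE.
have kg i j : k i != g j.
  by apply/eqP => E; have := vg j; rewrite -E vk.
have comp x y : x != v -> y != v -> adj x y = (x != y).
  move=> xv yv; have [->|xy] := eqVneq x y; first by rewrite adj_irr.
  by have /forallP/(_ y) := complete x; rewrite xv yv xy.
have h_inj : injective h.
  move=> [[i|i]|i] [[j|j]|j] //= E.
  - by rewrite (ord1 i) (ord1 j).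
  - by have := kv j; rewrite -E eqxx.
  - by have := gv j; rewrite -E eqxx.
  - by have := kv i; rewrite E eqxx.
  - by rewrite (k_inj _ _ E).
  - by have := kg i j; rewrite E eqxx.
  - by have := gv i; rewrite E eqxx.
  - by have := kg j i; rewrite E eqxx.
  - by rewrite (g_inj _ _ E).
have hA x y : adj (h x) (h y) = adj x y.
  case: x y => [[i|i]|i] [[j|j]|j] //=.
  - by rewrite adj_irr !ord1 /complete_adj eqxx.
  - by rewrite vg.
  - by rewrite adj_sym vk.
  - by rewrite comp // /complete_adj (inj_eq k_inj).
  - by rewrite comp // kg.
  - by rewrite adj_sym vg.
  - by rewrite comp // eq_sym kg.
  - by rewrite comp // /complete_adj (inj_eq g_inj).
(* By cardinality the injection [h] is bijective; the subtraction [#|G| - r - 1] is not truncated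
   because [v |: N] has [r + 1] elements. *)
have cG : #|G| <= #|extremal r #|G| |.
  rewrite !card_sum !card_ord -dv.
  have : #|v |: N| <= #|G| by exact: max_card.
  by rewrite cardsU1 vN /degree -/N; lia.
have [h' hK h'K] := inj_card_bij h_inj cG.
exists h'; first by exists h.
by move=> x y; rewrite -hA !h'K.
Qed.

(** * Minimum degree and the final bound *)

Lemma min_degreeP (G : sgraph) :
  min_degree G < #|G| -> exists v : G, degree v = min_degree G.
Proof.
(* The unit [#|G|] satisfies the implication vacuously, and a minimum is one of its two
   arguments. *)
rewrite /min_degree; elim/big_ind: _ => [|a b IHa IHb|x _ _]; first by rewrite ltnn.
  by rewrite /minn; case: ifP.
by exists x.
Qed.

Import Order.TTheory GRing.Theory Num.Theory.
Local Open Scope ring_scope.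

Definition tree_bound (r n : nat) : rat :=
  r%:R * n%:R ^+ (r - 1)%N * (n%:R - 1) ^ (n%:Z - r%:Z - 2%:Z).

(** This is [card_rooted] divided by [n - 1], nonzero because [n > r >= 1]. An integer exponent over
    the rationals is needed since [n - r - 2] is [-1] when [n = r + 1]. *)
Lemma card_rooted_neighbours (G : sgraph) (v : G) r : (0 < r)%N -> degree v = r ->
  #|rooted v [set y | adj v y]|%:R = tree_bound r #|G|.
Proof.
move=> r_gt0 dv; have vN : v \notin [set y | adj v y] by rewrite inE adj_irr.
have rG : (r < #|G|)%N.
  by have := max_card (mem (v |: [set y | adj v y])); rewrite cardsU1 vN -dv.
have G_gt1 : (1 < #|G|)%N by apply: leq_ltn_trans rG.
have := card_rooted vN G_gt1; rewrite -/(degree v) dv.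
case: #|G| rG G_gt1 => // m rm m_gt0 /= /(congr1 (fun k => k%:R : rat)).
have m_neq0 : m%:R != 0 :> rat by rewrite pnatr_eq0 -lt0n.
rewrite /tree_bound !natrM !natrX => E; apply: (mulfI m_neq0); rewrite E.
have -> : m.+1%:R - 1 = m%:R :> rat by rewrite -addn1 natrD addrK.
rewrite subn1 mulrCA; congr (_ * _).
rewrite exprnP -[X in X * _ ^ _]expr1z -expfzDr //; congr (_ ^ _); lia.
Qed.

Theorem theorem3p3 (r n : nat) (hr : (0 < r)%N) (hn : (0 < n)%N)
    (hrn : (r + 1 <= n)%N) (G : sgraph) (hG : #|G| = n)
    (hconn : edge_connectivity G = r) (hdeg : min_degree G = r) :
  let bound : rat :=
    r%:R * n%:R ^+ (r - 1)%N * (n%:R - 1) ^ (n%:Z - r%:Z - 2%:Z) in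
  (tau G)%:R <= bound /\
  ((tau G)%:R = bound <->
   graph_iso G (graph_join (graph_union (complete_graph 1)
                                        (complete_graph (n - r - 1)%N))
                           (complete_graph r))).
Proof.
rewrite -/(tree_bound r n) -/(extremal r n); move: hrn; rewrite -{}hG {n hn}.
rewrite addn1 => rG bound.
(* Stated for every vertex of degree [r]: the converse of the equality case uses the vertex supplied
   by the isomorphism, not the one chosen for the bound. *)
have tauE (v : G) : degree v = r -> (tau G)%:R <= bound /\
    ((tau G)%:R = bound <->
      [forall x, forall y, [&& x != v, y != v & x != y] ==> adj x y]).
  move=> dv; rewrite /bound -(card_rooted_neighbours hr dv) (tau_parents v).
  have [le_card eq_card] := subset_leqif_cards (parents_rooted v).
  rewrite ler_nat le_card -parents_rooted_eq -?[#|_|]/(degree v) ?dv // -eq_card.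
  split=> //; split=> [/eqP|/eqP ->//]; by rewrite eqr_nat.
have [v dv] : exists v : G, degree v = r.
  by rewrite -hdeg; apply: min_degreeP; rewrite hdeg.
have [le_bound eq_bound] := tauE v dv; split=> //; split=> [/eq_bound complete|].
  by apply/extremal_isoP; exists v.
by case/extremal_isoP => w [dw complete]; have [_ ->] := tauE w dw.
Qed.
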